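(* Let $f$ be a unimodal map satisfying the standing assumptions in the context. If $c$ is persistently recurrent, then the kneading sequence $\mathcal K(f)$ is not slowly recurrent.
   Context: A unimodal map is a continuous $f:[0,1]\to[0,1]$ with a turning point $c\in(0,1)$ such that $f|_{[0,c]}$ is strictly increasing and $f|_{[c,1]}$ is strictly decreasing; $c_i=f^i(c)$. Standing assumptions: $c_2<c<c_1$ and $c_2<c_3$; $f$ has no periodic attractor and is not renormalizable (there is no $n>1$ and interval $J\subset[c_2,c_1]$ containing $c$ with $f^n(J)\subset J$ and $J,f(J),\dots,f^{n-1}(J)$ having disjoint interiors); the contraction principle holds: for every $\varepsilon>0$ there is $\delta>0$ such that $|f^n(J)|>\delta$ for every $n>0$ and every interval $J$ with $|J|>\varepsilon$. The turning point is recurrent ($c\in\omega(c)$) and not periodic. $\mathcal K(f)=e_1e_2\cdots$ with $e_i=1$ if $c_i>c$ and $e_i=0$ if $c_i<c$. $\mathcal R(n)=\min\{j\ge1:e_{n+j}\ne e_j\}$. $\mathcal K(f)$ is slowly recurrent if $$\lim_{l\to\infty}\limsup_{i\to\infty}\frac1i\sum_{\substack{1\le j\le i\\ \mathcal R(j)\ge l}}\mathcal R(j)=0.$$ (Equivalently, with return times: let $S_0=1$, $S_{k+1}=S_k+\mathcal R(S_k)$ be the cutting times, $M_1=\min\{j>1:e_j=1\}-1$, $M_{i+1}=M_i+\mathcal R^-(M_i)$, where $\mathcal R^-(n)$ is the largest cutting time less than $\mathcal R(n)$; then the condition is $\lim_{l\to\infty}\limsup_{i\to\infty}\frac1{M_i}\sum_{j\le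 i,\ \mathcal R(M_j)\ge l}\mathcal R(M_j)=0$.) Persistent recurrence. For a finite backward orbit $\overline x=(x_{-l},\dots,x_{-1},x_0=x)$ and an interval $J\ni x$, the pull-back of $J$ along $\overline x$ is $J_0=J$, and $J_{k+1}\ni x_{-k-1}$ the largest interval with $f(J_{k+1})\subseteq J_k$; it is monotone if $c\notin J_k^\circ$ for all $1\le k\le l$. The recurrent point $c$ is reluctantly recurrent if there is $\delta>0$ such that for every $l\in\mathbb N$ there is a backward orbit $(x_{-l},\dots,x_{-1},x)$ in $\omega(c)$ such that $B(x,\delta)$ has a monotone pull-back along it; otherwise $c$ is persistently recurrent. *)

(* Defs.v *)
From HB Require Import structures.
From mathcomp Require Import all_boot all_order all_algebra.
From mathcomp Require Import all_classical all_reals all_analysis.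

Set Implicit Arguments.
Unset Strict Implicit.
Unset Printing Implicit Defensive.

Import Order.TTheory GRing.Theory Num.Theory.
Import numFieldNormedType.Exports.
Local Open Scope classical_set_scope.
Local Open Scope ring_scope.

(* A map [0,1] -> [0,1] is represented by a total function R -> R whose values
   outside [0,1] are irrelevant: every orbit and every interval below stays in
   [0,1]. *)

Definition unimodal (R : realType) (f : R -> R) (c : R) : Prop :=
  [/\ {within `[0, 1], continuous f},
      (forall x, x \in `[0, 1] -> f x \in `[0, 1]),
      0 < c < 1,
      {in `[0, c] &, forall x y, x < y -> f x < f y}
    & {in `[c, 1] &, forall x y, x < y -> f y < f x}].

Definition omega_limit (R : realType) (f : R -> R) (x : R) : set R :=
  cluster ((fun n => iter n f x) @ \oo).

Definition periodic (R : realType) (f : R -> R) (x : R) : Prop :=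
  exists n : nat, (0 < n)%N /\ iter n f x = x.

Definition basin (R : realType) (f : R -> R) (p : R) : set R :=
  [set x | x \in `[0, 1] /\ omega_limit f x = range (fun n => iter n f p)].

(* The basin only has to contain some open interval, so one-sided attractors
   are included. *)
Definition has_periodic_attractor (R : realType) (f : R -> R) : Prop :=
  exists p : R, [/\ p \in `[0, 1], periodic f p & (basin f p)° !=set0].

Definition renormalizable (R : realType) (f : R -> R) (c : R) : Prop :=
  exists (n : nat) (J : set R),
    [/\ (1 < n)%N,
        is_interval J /\ J `<=` `[iter 2 f c, iter 1 f c],
        J c,
        iter n f @` J `<=` J
      & forall i j : nat, (i < j < n)%N ->
          (iter i f @` J)° `&` (iter j f @` J)° = set0].

Definition len (R : realType) (J : set R) : R := sup J - inf J.

Definition contraction_principle (R : realType) (f : R -> R) : Prop :=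
  forall eps : R, 0 < eps -> exists2 delta : R, 0 < delta &
    forall (n : nat) (J : set R), (0 < n)%N ->
      is_interval J -> J `<=` `[0, 1] -> eps < len J ->
      delta < len (iter n f @` J).

Definition recurrent (R : realType) (f : R -> R) (c : R) : Prop :=
  omega_limit f c c.

Record standing_assumptions (R : realType) (f : R -> R) (c : R) : Prop := {
  sa_order : iter 2 f c < c < iter 1 f c;
  sa_order3 : iter 2 f c < iter 3 f c;
  sa_no_attractor : ~ has_periodic_attractor f;
  sa_not_renormalizable : ~ renormalizable f c;
  sa_contraction : contraction_principle f;
  sa_recurrent : recurrent f c;
  sa_not_periodic : ~ periodic f c }.

(* [true] is the symbol 1 and [false] the symbol 0; the entry at index 0 is
   never used, and iter i f c = c does not occur for i >= 1 when c is not
   periodic. *)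
Definition kneading (R : realType) (f : R -> R) (c : R) : nat -> bool :=
  fun i => c < iter i f c.

(* The minimum of the set of j >= 1 with e_(n+j) <> e_j, with value +oo if that
   set is empty. *)
Definition kneading_return (R : realType) (e : nat -> bool) (n : nat) : \bar R :=
  ereal_inf [set (j%:R)%:E | j in [set j : nat | (1 <= j)%N /\ e (n + j)%N != e j]].

Definition slowly_recurrent (R : realType) (e : nat -> bool) : Prop :=
  (fun l : nat => limn_esup (fun i : nat =>
     ((i%:R : R)^-1)%:E *
     \sum_(1 <= j < i.+1 | (l%:R)%:E <= kneading_return R e j)
        kneading_return R e j)%E) @ \oo --> 0%E.

(* x k stands for x_(-k); only the entries of index at most l matter. *)
Definition backward_orbit (R : realType) (f : R -> R) (l : nat) (x : nat -> R) :
  Prop := forall k : nat, (k < l)%N -> f (x k.+1) = x k.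

Definition largest_interval (R : realType) (P : set R -> Prop) (J : set R) :
  Prop :=
  [/\ is_interval J, P J & forall I, is_interval I -> P I -> I `<=` J].

Definition pull_back (R : realType) (f : R -> R) (l : nat) (x : nat -> R)
    (J0 : set R) (J : nat -> set R) : Prop :=
  J 0%N = J0 /\
  forall k : nat, (k < l)%N ->
    largest_interval
      (fun I => [/\ I `<=` `[0, 1], I (x k.+1) & f @` I `<=` J k]) (J k.+1).

Definition monotone_pull_back (R : realType) (c : R) (l : nat)
    (J : nat -> set R) : Prop :=
  forall k : nat, (1 <= k <= l)%N -> ~ (J k)° c.

Definition reluctantly_recurrent (R : realType) (f : R -> R) (c : R) : Prop :=
  recurrent f c /\
  exists2 delta : R, 0 < delta &
    forall l : nat, exists (x : nat -> R) (J : nat -> set R),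
      [/\ backward_orbit f l x,
          (forall k : nat, (k <= l)%N -> omega_limit f c (x k)),
          pull_back f l x (`[0, 1] `&` ball (x 0%N) delta) J
        & monotone_pull_back c l J].

Definition persistently_recurrent (R : realType) (f : R -> R) (c : R) : Prop :=
  recurrent f c /\ ~ reluctantly_recurrent f c.

(* Main.v *)
Require Import Defs.
From mathcomp Require Import all_boot all_order all_algebra.
From mathcomp Require Import all_classical all_reals all_analysis.
From mathcomp Require Import zify lra.

(** Suppose the kneading sequence is slowly recurrent, and write [R(j)] for its
    return function.  Fix [l] such that the [R(j) >= l] with [j <= i] sum to less
    than [i / 2] for all large [i].  By continuity and the contraction principle
    there is [delta > 0], depending on [l] only, with the following property.  If
    the pull-back of [B(c_n, delta)] along [c_n, c_(n-1), ...] first fails to be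
    monotone at step [k], then the interval between [c] and [c_(n-k)] is mapped
    into [B(c_n, delta)] by [f^k], so it is short; and its first [k - 1] images
    avoid [c].  Hence [R(n - k) >= max (k, l)], so that [n] lies in
    [(j, j + R(j)]] for some [j] with [R(j) >= l].  These intervals cover fewer
    than half of the integers up to [i], so along arbitrarily long stretches of
    the orbit of [c], contained in [omega(c)], the ball of radius [delta] has a
    monotone pull-back: [c] is reluctantly recurrent. *)

Set Implicit Arguments.
Unset Strict Implicit.
Unset Printing Implicit Defensive.

Import Order.TTheory GRing.Theory Num.Theory.
Import numFieldNormedType.Exports.
Local Open Scope classical_set_scope.
Local Open Scope ring_scope.

(** * Iterates on the unit interval and the limit set of a recurrent point *)

Lemma iter_stable (T : Type) (D : set T) (f : T -> T) :
  (forall x, D x -> D (f x)) -> forall n x, D x -> D (iter n f x).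
Proof. by move=> fD; elim=> [//|n IH] x Dx /=; apply/fD/IH. Qed.

Lemma within_continuous_iter (T : topologicalType) (D : set T) (f : T -> T) :
  (forall x, D x -> D (f x)) -> {within D, continuous f} ->
  forall n, {within D, continuous (iter n f)}.
Proof.
move=> fD /subspace_continuousP fc n; apply/subspace_continuousP.
elim: n => [|n IH] x Dx; first exact: (@cvg_within _ (nbhs x)).
have /= fcn := fc _ (iter_stable fD n Dx).
move=> B xB; have := IH _ Dx _ (fcn B xB).
by apply: (@filterS _ (nbhs x)) => y yB Dy; exact: yB Dy (iter_stable fD n Dy).
Qed.

Section OmegaLimit.
Variables (R : realType) (f : R -> R).
Hypotheses (fD : forall x, `[0, 1]%classic x -> `[0, 1]%classic (f x)).
Hypotheses (fc : {within `[0, 1], continuous f}).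

Lemma near_iter (n : nat) (x : R) (B : set R) :
  `[0, 1]%classic x -> nbhs (iter n f x) B ->
  \forall y \near x, `[0, 1]%classic y -> B (iter n f y).
Proof.
move=> Dx xB; have /subspace_continuousP := within_continuous_iter fD fc (n := n).
by move=> /(_ _ Dx B xB).
Qed.

(** The continuous map $f^i$ carries returns of the orbit close to $c$ to visits close to $c_i$.
    This puts backward orbits made of points $c_i$ inside $\omega(c)$. *)
Lemma recurrent_orbit_omega_limit (c : R) (i : nat) :
  `[0, 1]%classic c -> recurrent f c -> omega_limit f c (iter i f c).
Proof.
move=> Dc rc A B [N _ NA] /(near_iter Dc) iB.
have NF : ((fun n => iter n f c) @ \oo) [set iter n f c | n in [set n | (N <= n)%N]].
  by exists N => // n /= Nn; exists n.
have [_ [[n Nn <-] cB]] := rc _ _ NF iB.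
exists (iter (i + n) f c); split; first exact/NA/(leq_trans Nn (leq_addl i n)).
by rewrite iterD; exact: cB (iter_stable fD n Dc).
Qed.

End OmegaLimit.

(** * Existence of pull-backs and their images under iterates *)

Section PullBack.
Variables (R : realType) (f : R -> R).
Hypotheses (fD : forall x, `[0, 1]%classic x -> `[0, 1]%classic (f x)).

Let candidate (y : R) (K : set R) : set (set R) :=
  [set I | is_interval I /\ [/\ I `<=` `[0, 1], I y & f @` I `<=` K]].

Let preimage_component (y : R) (K : set R) : set R :=
  \bigcup_(I in candidate y K) I.

(** All candidates share the point [y], so their union is again an interval; the singleton of [y] is
    a candidate, so the union contains [y]. *)
Let preimage_component_largest (y : R) (K : set R) :
  `[0, 1]%classic y -> K (f y) ->
  largest_interval (fun I => [/\ I `<=` `[0, 1], I y & f @` I `<=` K])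
    (preimage_component y K).
Proof.
move=> Dy Ky; split.
- move=> a b [I [Ii [I01 Iy IK]] Ia] [I' [Ii' [I01' Iy' IK']] Ib] z /andP[az zb].
  have [zy|yz] := leP z y.
    by exists I => //; apply: (Ii a y) => //; rewrite az.
  by exists I' => //; apply: (Ii' y b) => //; rewrite (ltW yz).
- split.
  + by move=> z [I [_ [I01 _ _]]] /I01.
  + exists [set y] => //; split; last first.
      by split => //; [move=> _ -> | move=> _ [_ -> <-]].
    by move=> a b /= -> -> z zab; apply/le_anti; rewrite andbC.
  + by move=> _ [z [I [_ [_ _ IK]] Iz] <-]; apply: IK; exists z.
- by move=> I Ii HI z Iz; exists I.
Qed.

Lemma pull_back_exists (l : nat) (x : nat -> R) (K : set R) :
  backward_orbit f l x -> (forall k, (k <= l)%N -> `[0, 1]%classic (x k)) ->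
  K (x 0%N) -> exists J, pull_back f l x K J.
Proof.
move=> bx Dx Kx.
pose J := fix J k := if k is k'.+1 then preimage_component (x k) (J k') else K.
have Jlarge k : (k < l)%N -> J k (x k) ->
    largest_interval
      (fun I => [/\ I `<=` `[0, 1], I (x k.+1) & f @` I `<=` J k]) (J k.+1).
  move=> kl Jk; apply: preimage_component_largest; first exact: Dx.
  by rewrite bx.
have Jx k : (k <= l)%N -> J k (x k).
  elim: k => [//|k IH] kl.
  by have [_ [_]] := Jlarge _ kl (IH (ltnW kl)).
by exists J; split => // k kl; apply/Jlarge/Jx => //; apply: ltnW.
Qed.

Variables (l : nat) (x : nat -> R) (K : set R) (J : nat -> set R).
Hypotheses (Kint : is_interval K) (xK : K (x 0%N)) (JK : pull_back f l x K J).

Lemma pull_back_interval k : (k <= l)%N -> is_interval (J k).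
Proof.
have [J0 JS] := JK.
by case: k => [_|k kl]; [rewrite J0 | have [] := JS _ kl].
Qed.

Lemma pull_back_mem k : (k <= l)%N -> J k (x k).
Proof.
have [J0 JS] := JK.
by case: k => [_|k kl]; [rewrite J0 | have [_ [_]] := JS _ kl].
Qed.

Lemma pull_back_iter j k y :
  (j <= k)%N -> (k <= l)%N -> J k y -> J (k - j)%N (iter j f y).
Proof.
have [_ JS] := JK.
elim: j => [|j IH] jk kl Jy; first by rewrite subn0.
have {IH} := IH (ltnW jk) kl Jy.
have -> : (k - j = (k - j.+1).+1)%N by lia.
have [|_ [_ _ sub] _] := JS (k - j.+1)%N; first lia.
by move=> Jj; apply: sub; exists (iter j f y).
Qed.

End PullBack.

(** * Intervals and their lengths *)

Lemma interior_interval_between (R : realType) (I : set R) (a b c : R) :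
  is_interval I -> I a -> I b -> a < c < b -> I° c.
Proof.
move=> Ii Ia Ib acb; have : nbhs c `]a, b[%classic by apply: near_in_itvoo; rewrite in_itv.
apply: filterS => z /=; rewrite in_itv /= => /andP[az zb].
by apply: (Ii a b) => //; rewrite (ltW az) (ltW zb).
Qed.

(** Supplies the segment from $c$ to an orbit point to which the contraction principle is applied;
    the order of the two ends is not known there. *)
Lemma itv_between (R : realType) (I : set R) (a b : R) :
  is_interval I -> I a -> I b ->
  exists S : set R, [/\ is_interval S, S `<=` I, S a, S b & len S = `|b - a|].
Proof.
move=> Ii Ia Ib; exists `[Num.min a b, Num.max a b]%classic; split.
- exact: interval_is_interval.
- move=> z /=; rewrite in_itv /= => /andP[mz zM]; have [ab|/ltW ab] := leP a b.
    by apply: (Ii a b) => //; rewrite (min_l ab) in mz; rewrite (max_r ab) in zM; rewrite mz.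
  by apply: (Ii b a) => //; rewrite (min_r ab) in mz; rewrite (max_l ab) in zM; rewrite mz.
- by rewrite /= in_itv /= ge_min le_max lexx.
- by rewrite /= in_itv /= ge_min le_max lexx !orbT.
- have mM : Num.min a b <= Num.max a b by rewrite ge_min !le_max lexx.
  rewrite /len sup_itvcc // inf_itvcc //.
  by have [ab|/ltW ab] := leP a b; [rewrite ger0_norm|rewrite ler0_norm]; lra.
Qed.

Lemma len_sub_ball (R : realType) (x d : R) (A : set R) :
  A !=set0 -> A `<=` ball x d -> len A <= d *+ 2.
Proof.
move=> A0 Ad; have bd y : A y -> x - d <= y <= x + d.
  move=> /Ad; rewrite /ball /= ltr_norml => /andP[? ?]; apply/andP; split; lra.
have : sup A <= x + d by apply: ge_sup => // y /bd /andP[].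
have : x - d <= inf A by apply: lb_le_inf => // y /bd /andP[].
rewrite /len; lra.
Qed.

(** * The return function and a covering estimate *)

Section KneadingReturn.
Variables (R : realType) (e : nat -> bool).

Lemma kneading_return_ge (n m : nat) :
  (forall j, (1 <= j < m)%N -> e (n + j)%N = e j) ->
  ((m%:R)%:E <= kneading_return R e n)%E.
Proof.
move=> h; apply/ereal_infP => _ [j [j1 /eqP ej] <-].
rewrite lee_fin ler_nat leqNgt; apply/negP => jm.
by apply: ej; apply: h; rewrite j1.
Qed.

Lemma slowly_recurrent_sum : slowly_recurrent R e ->
  exists l i0 : nat, forall i, (i0 <= i)%N -> (0 < i)%N ->
    (\sum_(1 <= j < i.+1 | (l%:R)%:E <= kneading_return R e j)
        kneading_return R e j < (i%:R / 2)%:E)%E.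
Proof.
move=> sr.
have : nbhs (0%E : \bar R) [set y | (y < (2^-1)%:E)%E].
  by apply: open_nbhs_nbhs; split; [exact: open_ereal_lt_ereal | rewrite /= lte_fin invr_gt0].
(* The upper limit is an infimum of suprema over sets of the filter, so one tail already has
   supremum below $1/2$. *)
move=> /sr [l _ /(_ l (leqnn l))] /= /ereal_inf_lt [_ [V [i0 _ i0V] <-] Vlt].
exists l, i0 => i ii0 i1.
have := le_lt_trans (ereal_sup_ubound (imageP _ (i0V i ii0))) Vlt.
by rewrite lte_pdivrMl ?ltr0n // EFinM.
Qed.

End KneadingReturn.

(** Charge each $n$ to some $j = g(n)$. The integers charged to $j$ lie in a block that starts at
    $j+1$ and has length at most $W(j)$; the blocks together contain all $b-a$ integers. *)
Lemma covering_sum_ge (R : realType) (W : nat -> \bar R) (a b : nat) :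
  (forall j, (0 <= W j)%E) ->
  (forall n, (a < n <= b)%N ->
    exists2 j, (1 <= j < n)%N & (((n - j)%:R)%:E <= W j)%E) ->
  (((b - a)%:R)%:E <= \sum_(1 <= j < b.+1) W j)%E.
Proof.
move=> W0 cov.
have [g gP] : exists g : nat -> nat, forall n, (a < n <= b)%N ->
    (1 <= g n < n)%N /\ (((n - g n)%:R)%:E <= W (g n))%E.
  have /choice [g gP] : forall n, exists j, (a < n <= b)%N ->
      (1 <= j < n)%N /\ (((n - j)%:R)%:E <= W j)%E.
    move=> n; have [/cov[j ? ?]|_] := boolP (a < n <= b)%N; last by exists 0%N.
    by exists j.
  by exists g.
(* The block of $j$ reaches just as far as the farthest integer charged to $j$, and is empty if
   there is none. Its length is a natural number even where [W j] is infinite. *)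
pose m j := (\max_(n < b.+1 | (a < n)%N && (g n == j)) (n - j))%N.
have mW j : (((m j)%:R)%:E <= W j)%E.
  rewrite /m; elim/big_ind: _ => [||[n nb] /= /andP[an /eqP gn]]; first exact: W0.
    by move=> p q ? ?; rewrite /maxn; case: ifP.
  by rewrite -gn; apply: (gP n _).2; rewrite an -ltnS.
pose blocks := flatten [seq iota j.+1 (m j) | j <- index_iota 1 b.+1].
have sub : {subset iota a.+1 (b - a) <= blocks}.
  move=> n; rewrite mem_iota => nab; have {}nab : (a < n <= b)%N by lia.
  have [gn _] := gP n nab; apply/flatten_mapP.
  have nb : (n < b.+1)%N by lia.
  exists (g n); first by rewrite mem_index_iota; lia.
  have : (n - g n <= m (g n))%N.
    by apply: (leq_bigmax_cond (Ordinal nb)); rewrite /= eqxx andbT; lia.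
  by rewrite mem_iota; lia.
have := uniq_leq_size (iota_uniq _ _) sub.
rewrite size_iota size_flatten /shape -map_comp sumnE big_map => le_ba.
apply: (@le_trans _ _ ((\sum_(1 <= j < b.+1) m j)%:R)%:E).
  rewrite lee_fin ler_nat; apply: leq_trans le_ba _.
  by under eq_bigr do rewrite /= size_iota.
by rewrite natr_sum -sumEFin; apply: lee_sum => j _; apply: mW.
Qed.

(** * Nonmonotone pull-backs force long returns *)

Section UnimodalMap.
Variables (R : realType) (f : R -> R) (c : R).
Hypotheses (hf : unimodal f c) (hs : standing_assumptions f c).

Let fD x : `[0, 1]%classic x -> `[0, 1]%classic (f x).
Proof. by have [_ fD _ _ _] := hf; apply: fD. Qed.

Let fc : {within `[0, 1], continuous f}.
Proof. by case: hf. Qed.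

Let Dc : `[0, 1]%classic c.
Proof. by have [_ _ /andP[c0 c1] _ _] := hf; rewrite /= in_itv /= !ltW. Qed.

Let iter_c_neq n : (0 < n)%N -> iter n f c != c.
Proof. by move=> n0; apply/eqP => cn; apply: (sa_not_periodic hs); exists n. Qed.

(** Since $c_j \ne c$ for $j \ge 1$, the side of $c$ on which $f^j(y)$ lies is constant for $y$ near
    $c$; only finitely many $j$ are involved. *)
Lemma near_same_itinerary (l : nat) :
  exists2 eps : R, 0 < eps & forall y, `[0, 1]%classic y -> `|y - c| <= eps ->
    forall j, (1 <= j < l)%N -> (c < iter j f y) = (c < iter j f c).
Proof.
have near_one j : (0 < j)%N -> \forall y \near c, `[0, 1]%classic y ->
    (c < iter j f y) = (c < iter j f c).
  move=> /iter_c_neq /lt_total /orP[cj|cj].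
    have /(near_iter fD fc Dc) : nbhs (iter j f c) [set z | z < c] by exact: lt_nbhsl.
    by apply: filterS => y h /h /= yc; rewrite !ltNge !ltW.
  have /(near_iter fD fc Dc) : nbhs (iter j f c) [set z | c < z] by exact: lt_nbhsr.
  by apply: filterS => y h /h /= ->; rewrite cj.
have near_all : \forall y \near c, forall j, (1 <= j < l)%N -> `[0, 1]%classic y ->
    (c < iter j f y) = (c < iter j f c).
  elim: l => [|l IH]; first by apply: (@nearW _ (nbhs c)) => y j; rewrite andbC.
  have [l0|l0] := posnP l; first by apply: (@nearW _ (nbhs c)) => y j; rewrite l0; lia.
  move: (near_one l l0) IH; apply: (@filterS2 _ (nbhs c)) => y yl IH j.
  rewrite ltnS => /andP[j1]; rewrite leq_eqVlt => /orP[/eqP->|jl]; first exact: yl.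
  by apply: IH; rewrite j1.
have /nbhs_ballP[eps eps0 ball_eps] := near_all.
exists (eps / 2) => [|y Dy yc j jl]; first by rewrite divr_gt0.
apply: ball_eps => //; rewrite /ball /= distrC; apply: le_lt_trans yc _.
by rewrite ltr_pdivrMr // mulr_natr mulr2n ltrDl.
Qed.

(** The bound by [l] comes from the contraction principle, which makes $c_{n-k}$ close to $c$; the
    bound by [k] comes from the minimality of the nonmonotone step. *)
Lemma first_nonmonotone_step_return (l : nat) :
  exists2 delta : R, 0 < delta & forall (L n k : nat) (J : nat -> set R),
    (L < n)%N -> (1 <= k <= L)%N ->
    pull_back f L (fun i => iter (n - i) f c)
      (`[0, 1] `&` ball (iter n f c) delta) J ->
    (J k)° c -> (forall j, (1 <= j < k)%N -> ~ (J j)° c) ->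
    forall m, m = l \/ m = k ->
      ((m%:R)%:E <= kneading_return R (kneading f c) (n - k))%E.
Proof.
have [eps eps0 same] := near_same_itinerary l.
have [d d0 contr] := sa_contraction hs eps0.
have d20 : 0 < d / 2 by rewrite divr_gt0.
(* A ball of radius $d/2$ has length at most $d$, which the image of an interval longer than [eps]
   must exceed. *)
exists (d / 2) => // L n k J Ln kL pb Jc first m.
have Dn i : `[0, 1]%classic (iter i f c) by exact: (iter_stable fD).
set K := _ `&` _ in pb; set x := (fun i => _) in pb.
have Kint : is_interval K.
  move=> a b [Da Ba] [Db Bb] z zab; split.
    by apply: (@interval_is_interval _ `[0, 1]) zab.
  move: Ba Bb zab; rewrite /ball /= !ltr_norml => /andP[? ?] /andP[? ?] /andP[? ?].
  by apply/andP; split; lra.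
have Kx : K (x 0%N) by split; rewrite /x subn0 //; exact: ballxx.
have kn : (k <= L)%N by case/andP: kL.
have Jx : J k (x k) := pull_back_mem Kx pb kn.
have Jkc : J k c := interior_subset Jc.
have [S [Si SJ Sc Sx lenS]] := itv_between (pull_back_interval Kint pb kn) Jkc Jx.
have SD : S `<=` `[0, 1].
  have [_ JS] := pb; case: (k) kL SJ => [//|k'] kL SJ.
  by have [_ [JD _ _] _] := JS k' ltac:(lia); apply: subset_trans JD.
have xc : `|x k - c| <= eps.
  rewrite -lenS leNgt; apply/negP => /(contr k S _ Si SD) => /(_ ltac:(lia)).
  apply/negP; rewrite -leNgt.
  have -> : d = d / 2 *+ 2 by lra.
  apply: (@len_sub_ball _ (iter n f c)); first by exists (iter k f c); exists c.
  move=> _ [y /SJ Jy <-]; have [J0 _] := pb.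
  by have := pull_back_iter pb (leqnn k) kn Jy; rewrite subnn J0 => -[].
move=> mlk; apply: kneading_return_ge => j jm; rewrite /kneading addnC iterD.
case: mlk => mE; rewrite {}mE {m} in jm; first exact: same (Dn _) xc _ jm.
have kj : (k - j <= L)%N by lia.
have Jj := pull_back_iter pb (ltnW (proj2 (andP jm))) kn.
have Jint := pull_back_interval Kint pb kj.
have := first (k - j)%N ltac:(lia).
have xj : x k = iter (n - k) f c by [].
have cj : c != iter j f c by rewrite eq_sym iter_c_neq; lia.
have cx : c != iter j f (x k) by rewrite eq_sym /x -iterD iter_c_neq; lia.
(* Both $c_j$ and $f^j(x_k)$ lie in $J_{k-j}$. If $c$ separated them, it would be interior to
   $J_{k-j}$, against the minimality of $k$. *)
rewrite -xj; have [cxj|] := ltP c (iter j f (x k)).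
  have [//|] := ltP c (iter j f c).
  rewrite le_eqVlt eq_sym (negPf cj) /= => cjc.
  by case; apply: (interior_interval_between Jint (Jj _ Jkc) (Jj _ Jx)); rewrite cjc.
rewrite le_eqVlt eq_sym (negPf cx) /= => xjc.
have [cjc|//] := ltP c (iter j f c).
by case; apply: (interior_interval_between Jint (Jj _ Jx) (Jj _ Jkc)); rewrite cjc xjc.
Qed.

Lemma slowly_recurrent_reluctantly_recurrent :
  slowly_recurrent R (kneading f c) -> reluctantly_recurrent f c.
Proof.
have rc := sa_recurrent hs.
move=> /slowly_recurrent_sum [l [i0 small]]; split=> //.
have [delta delta0 retn] := first_nonmonotone_step_return l.
exists delta => // L.
have Dn i : `[0, 1]%classic (iter i f c) by exact: (iter_stable fD).
pose x n k := iter (n - k) f c.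
have bo n : (L < n)%N -> backward_orbit f L (x n).
  by move=> Ln k kL; rewrite /x -iterS; congr (iter _ f c); lia.
have pbe n : (L < n)%N ->
    exists J, pull_back f L (x n) (`[0, 1] `&` ball (iter n f c) delta) J.
  move=> Ln; apply: pull_back_exists; [exact: bo | by move=> k _; apply: Dn |].
  by split; rewrite /x subn0 //; exact: ballxx.
pose monotone n := exists2 J,
  pull_back f L (x n) (`[0, 1] `&` ball (iter n f c) delta) J &
  monotone_pull_back c L J.
have [[n [Ln [J pb mono]]]|none] := pselect (exists n, (L < n)%N /\ monotone n).
  exists (x n), J; split=> //; first exact: bo.
    by move=> k kL; apply: recurrent_orbit_omega_limit.
  by rewrite {2}/x subn0.
(* With $i \ge 2L$, the integers in $(L, i]$ number at least $i/2$, so covering them contradicts the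
   bound on the sum. *)
exfalso; pose i := maxn (maxn i0 L.*2) 1.
have {small} := small i ltac:(lia) ltac:(lia).
apply/negP; rewrite -leNgt big_mkcond /=.
apply: (@le_trans _ _ (((i - L)%:R)%:E)).
  rewrite lee_fin ler_pdivrMr // -natrM ler_nat; lia.
apply: covering_sum_ge => [j|n /andP[Ln ni]].
  by case: ifP => // _; apply: (@kneading_return_ge _ _ _ 0) => t; rewrite andbC.
have [J pb] := pbe n Ln.
have exk : exists k, `[< (1 <= k <= L)%N /\ (J k)° c >].
  apply: contrapT => nok; apply: none; exists n; split=> //.
  exists J => // k kL Jc; apply: nok; exists k; exact/asboolP.
case: (ex_minnP exk) => k /asboolP[kL Jc] kmin.
have ge_ret := retn _ _ _ _ Ln kL pb Jc _.
have {}ge_ret m : m = l \/ m = k ->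
    ((m%:R)%:E <= kneading_return R (kneading f c) (n - k))%E.
  apply: ge_ret => j jk Jjc; have := kmin j; rewrite leqNgt => /(_ _) kj.
  by move: (kj ltac:(by apply/asboolP; split=> //; lia)); lia.
(* As $k \le L < n$, this index is at least 1. The bound by [l] makes its term count in the sum, and
   the bound by [k] makes its block reach $n$. *)
exists (n - k)%N; first lia.
rewrite ge_ret; last by left.
by have -> : (n - (n - k) = k)%N by [lia]; apply: ge_ret; right.
Qed.

End UnimodalMap.

Theorem proposition5p2 (R : realType) (f : R -> R) (c : R)
    (hf : unimodal f c) (hs : standing_assumptions f c)
    (hc : persistently_recurrent f c) :
  ~ slowly_recurrent R (kneading f c).
Proof.
by move=> /(slowly_recurrent_reluctantly_recurrent hf hs); apply: hc.2.
Qed.
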